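(* For any admissible family $f_n$ of order $m$, the linear space $V_{f_n}$ over the field of rational functions $K(x)$ generated by the set of shifted derivatives $\{ f_{n\pm k}^{(j)} \mid j,k\in\mathbb{N}_0\}$ is at most $m$-dimensional. On the other hand, if the family $\{ f_{n\pm k}^{(j)} \mid j,k\in\mathbb{N}_0\}$ spans an $m$-dimensional linear space over $K(x)$, then $f_n$ forms an admissible family of order $m$.
   Context: $K$ is one of $\mathbb{Q},\mathbb{R},\mathbb{C}$, and $K(x)$ denotes the field of rational functions over $K$. A family $(f_n)_{n\in D}$ consists of functions $f_n(x)=f(n,x)$ of a continuous variable $x\in I$ ($I$ a finite or infinite real interval or a subset of $\mathbb{C}$), indexed by a discrete variable $n\in D$, where $D$ has the property $n\in D\Rightarrow n+1\in D$ (or $n\in D\Rightarrow n-1\in D$), e.g. $D=\mathbb{N}_0,\mathbb{Z},\mathbb{R}$ or $\mathbb{C}$; only indices lying in $D$ are considered. The symbol $f^{(j)}$ denotes the $j$-th derivative with respect to $x$. Derivative rule: the $f_n$ are differentiable with respect to $x$ and, for some $M\in\mathbb{N}$, either $f_n'(x)=\sum_{k=0}^{M-1} r_k(n,x)f_{n-k}(x)$ (backward) or $f_n'(x)=\sum_{k=0}^{M-1} r_k(n,x)f_{n+k}(x)$ (forward), where the $r_k$ are rational functions in $x$ (with coefficients in $K$). If $r_{M-1}(n,x)\not\equiv 0$, the order of the derivative rule is $M$. In an admissible family the order of the derivative rule can always be assumed to be at most the order of the recurrence equation. Recurrence equation: $\sum_{k=0}^m q_k(n,x)f_{n-k}(x)=0$,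 where $m\in\mathbb{N}$ and the $q_k$ are polynomials in $x$ (with coefficients in $K$). If $q_0(n,x)\not\equiv 0$ and $q_m(n,x)\not\equiv 0$, the order of the recurrence equation is $m$. The family $f_n$ is called admissible if it satisfies a recurrence equation and a derivative rule of these types; the order of the admissible family is the order of the recurrence equation.
   Formalization: The converse fails as stated (f_n = sin x for all n spans dimension 2 but has no derivative rule); it is proved assuming also that any m consecutive members f_n,…,f_{n-m+1} are linearly independent over K(x), which is necessary for it to hold. *)

(* Defs.v *)
From HB Require Import structures.
From mathcomp Require Import all_boot all_order all_algebra.
From mathcomp Require Import generic_quotient ring_quotient fraction complex.
From mathcomp Require Import all_classical all_reals all_analysis.
Set Implicit Arguments.
Unset Strict Implicit.
Unset Printing Implicit Defensive.
Import Order.TTheory GRing.Theory Num.Theory numFieldNormedType.Exports.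
Local Open Scope classical_set_scope.
Local Open Scope ring_scope.

Section LinearSpan.
Variables (F : fieldType) (V : lmodType F).

Definition span (S : set V) : set V :=
  [set v | exists (d : nat) (a : 'I_d -> F) (s : 'I_d -> V),
     (forall i, S (s i)) /\ v = \sum_(i < d) a i *: s i].

Definition lin_indep (d : nat) (b : 'I_d -> V) : Prop :=
  forall a : 'I_d -> F, \sum_(i < d) a i *: b i = 0 -> forall i, a i = 0.

Definition has_dim (W : set V) (d : nat) : Prop :=
  exists b : 'I_d -> V, lin_indep b /\ W = span (range b).

Definition dim_le (W : set V) (m : nat) : Prop :=
  exists2 d, (d <= m)%N & has_dim W d.

End LinearSpan.

(* A function with values in C is multiplied by an element of K(x) only away
   from finitely many poles.  The K(x)-vector space in which all spans are taken
   is therefore the space of functions on I modulo functions vanishing at all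
   but finitely many points of I.  When I has no isolated point, two continuous
   functions have the same class iff they agree everywhere on I. *)
Section FunctionSpace.
Variables (C : numClosedFieldType) (I : set C).

Definition negligible_fun : {pred C -> C} :=
  [pred f : C -> C | `[< finite_set [set x | I x /\ f x <> 0] >]].

Lemma negligible_funP (f : C -> C) :
  reflect (finite_set [set x | I x /\ f x <> 0]) (f \in negligible_fun).
Proof. exact: asboolP. Qed.

Lemma negligible_fun_zmod_closed : zmod_closed negligible_fun.
Proof.
split=> [|f g /negligible_funP ff /negligible_funP fg]; apply/negligible_funP.
  by apply: (sub_finite_set _ (finite_set0 C)) => x /= [_ []].
apply: (sub_finite_set (B := [set x | I x /\ f x <> 0] `|` [set x | I x /\ g x <> 0])).
  move=> x /= [Ix fgx]; case: (pselect (f x = 0)) => [fx|]; last by left.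
  by right; split=> // gx; apply: fgx; rewrite [LHS](_ : _ = f x - g x) // fx gx subr0.
by rewrite finite_setU.
Qed.

HB.instance Definition _ :=
  GRing.isZmodClosed.Build (C -> C) negligible_fun negligible_fun_zmod_closed.

End FunctionSpace.

(* iota plays no role in the carrier: it selects the scalars, so that the vector
   spaces over Q(x), R(x) and C(x) are different structures. *)
Definition fun_space (K : fieldType) (C : numClosedFieldType)
    (iota : {rmorphism K -> C}) (I : set C) : Type :=
  {ideal_quot (@negligible_fun C I)}.

HB.instance Definition _ (K : fieldType) (C : numClosedFieldType)
    (iota : {rmorphism K -> C}) (I : set C) :=
  GRing.Zmodule.on (fun_space iota I).

Section FunctionModule.
Variables (K : fieldType) (C : numClosedFieldType) (iota : {rmorphism K -> C}).

Local Notation num a := (frac a).1.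
Local Notation den a := (frac a).2.

Definition poly_eval (p : {poly K}) (x : C) : C := (map_poly iota p).[x].

(* The value depends on the chosen representative only at the finitely many
   zeros of its denominator. *)
Definition ratfun_eval (r : {fraction {poly K}}) (x : C) : C :=
  poly_eval (num (repr r)) x / poly_eval (den (repr r)) x.

Lemma finite_poly_zeros (p : {poly K}) : p != 0 ->
  finite_set [set x | poly_eval p x = 0].
Proof.
move=> p0; have q0 : map_poly iota p != 0 by rewrite map_poly_eq0.
have [rs rsE] := closed_field_poly_normal (map_poly iota p).
apply: (sub_finite_set (B := [set` rs])); last exact: finite_seq.
move=> x /= px; rewrite /poly_eval in px.
have : root (map_poly iota p) x by apply/rootP.
rewrite rsE rootZ ?lead_coef_eq0 //.
by rewrite root_prod_XsubC.
Qed.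

Lemma poly_evalM p q x : poly_eval (p * q) x = poly_eval p x * poly_eval q x.
Proof. by rewrite /poly_eval rmorphM hornerM. Qed.

Lemma poly_evalD p q x : poly_eval (p + q) x = poly_eval p x + poly_eval q x.
Proof. by rewrite /poly_eval rmorphD hornerD. Qed.

Lemma poly_eval1 x : poly_eval 1 x = 1.
Proof. by rewrite /poly_eval rmorph1 hornerC. Qed.

Lemma ratfun_eval_pi (a : {ratio {poly K}}) (r : {fraction {poly K}}) (x : C) :
  r = (\pi_({fraction {poly K}}) a)%qT -> poly_eval (den a) x <> 0 -> poly_eval (den (repr r)) x <> 0 ->
  ratfun_eval r x = poly_eval (num a) x / poly_eval (den a) x.
Proof.
move=> -> /eqP da /eqP dr.
rewrite /ratfun_eval; apply/eqP; rewrite eqr_div //; apply/eqP.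
rewrite -!poly_evalM; congr poly_eval.
by rewrite (FracField.equivf_l a) mulrC.
Qed.

Lemma finite_denom_zeros (a : {ratio {poly K}}) :
  finite_set [set x | poly_eval (den a) x = 0].
Proof. exact/finite_poly_zeros/denom_ratioP. Qed.

Lemma ratfun_evalD (r s : {fraction {poly K}}) :
  finite_set [set x | ratfun_eval (r + s) x <> ratfun_eval r x + ratfun_eval s x].
Proof.
set a := repr r; set b := repr s; set c := repr (r + s).
apply: (sub_finite_set (B := [set x | poly_eval (den a) x = 0] `|`
   ([set x | poly_eval (den b) x = 0] `|` [set x | poly_eval (den c) x = 0]))); last first.
  by rewrite !finite_setU; split; [|split]; exact: finite_denom_zeros.
move=> x /=; apply: contra_notP => /not_orP[da /not_orP[db dc]].
have rsE : r + s = (\pi_({fraction {poly K}}) (FracField.addf a b))%qT.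
  rewrite -[LHS](_ : \pi_({fraction {poly K}})%qT a + \pi_({fraction {poly K}})%qT b = _).
    exact/esym/FracField.pi_add.
  by rewrite !reprK.
have nab : (den a) * (den b) != 0 by rewrite mulf_neq0 // denom_ratioP.
have nE : (num (FracField.addf a b)) = (num a) * (den b) + (num b) * (den a).
  by rewrite numer_Ratio.
have dE : (den (FracField.addf a b)) = (den a) * (den b) by rewrite denom_Ratio.
rewrite (ratfun_eval_pi rsE) //.
  rewrite nE dE poly_evalD !poly_evalM /ratfun_eval -/a -/b addf_div //; exact/eqP.
by rewrite dE poly_evalM; apply/eqP; rewrite mulf_neq0 //; exact/eqP.
Qed.

Lemma ratfun_evalM (r s : {fraction {poly K}}) :
  finite_set [set x | ratfun_eval (r * s) x <> ratfun_eval r x * ratfun_eval s x].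
Proof.
set a := repr r; set b := repr s; set c := repr (r * s).
apply: (sub_finite_set (B := [set x | poly_eval (den a) x = 0] `|`
   ([set x | poly_eval (den b) x = 0] `|` [set x | poly_eval (den c) x = 0]))); last first.
  by rewrite !finite_setU; split; [|split]; exact: finite_denom_zeros.
move=> x /=; apply: contra_notP => /not_orP[da /not_orP[db dc]].
have rsE : r * s = (\pi_({fraction {poly K}}) (FracField.mulf a b))%qT.
  rewrite -[LHS](_ : \pi_({fraction {poly K}})%qT a * \pi_({fraction {poly K}})%qT b = _).
    exact/esym/FracField.pi_mul.
  by rewrite !reprK.
have nab : (den a) * (den b) != 0 by rewrite mulf_neq0 // denom_ratioP.
have nE : (num (FracField.mulf a b)) = (num a) * (num b) by rewrite numer_Ratio.
have dE : (den (FracField.mulf a b)) = (den a) * (den b) by rewrite denom_Ratio.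
rewrite (ratfun_eval_pi rsE) //.
  by rewrite nE dE !poly_evalM /ratfun_eval -/a -/b mulf_div.
by rewrite dE poly_evalM; apply/eqP; rewrite mulf_neq0 //; exact/eqP.
Qed.

Lemma ratfun_eval1 : finite_set [set x | ratfun_eval 1 x <> 1].
Proof.
set a := Ratio (1 : {poly K}) 1; set c := repr (1 : {fraction {poly K}}).
apply: (sub_finite_set (B := [set x | poly_eval (den c) x = 0])); last first.
  exact: finite_denom_zeros.
move=> x /=; apply: contra_notP => dc.
have E : (1 : {fraction {poly K}}) = (\pi_({fraction {poly K}}) a)%qT.
  by rewrite -tofrac1 /FracField.tofrac -lock.
rewrite (ratfun_eval_pi E) // /a ?denom_Ratio ?numer_Ratio ?oner_neq0 // poly_eval1.
  by rewrite divr1.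
exact/eqP/oner_neq0.
Qed.

Variable I : set C.

Local Notation fun_space := (fun_space iota I).

Definition cls (f : C -> C) : fun_space :=
  (\pi_({ideal_quot (@negligible_fun C I)}) f)%qT.

Lemma cls_eq (f g : C -> C) :
  cls f = cls g <-> finite_set [set x | I x /\ f x <> g x].
Proof.
have -> : [set x | I x /\ f x <> g x] = [set x | I x /\ (f - g) x <> 0].
  apply/seteqP; split=> x /= [Ix h]; split=> // e; apply: h.
    by apply/eqP; rewrite -subr_eq0; apply/eqP.
  by rewrite [LHS](_ : _ = f x - g x) // e subrr.
split=> [/eqP|h].
  by rewrite -Quotient.idealrBE => /negligible_funP.
by apply/eqP; rewrite -Quotient.idealrBE; apply/negligible_funP.
Qed.

Lemma clsD (f g : C -> C) : cls (f + g) = cls f + cls g.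
Proof. by rewrite /cls !piE. Qed.

Lemma cls_repr (u : fun_space) : cls (repr u) = u.
Proof. by rewrite /cls reprK. Qed.

Definition fun_space_scale (r : {fraction {poly K}}) (u : fun_space) : fun_space :=
  cls (fun x => ratfun_eval r x * repr u x).

Lemma fun_space_scaleE r (f : C -> C) :
  fun_space_scale r (cls f) = cls (fun x => ratfun_eval r x * f x).
Proof.
apply/cls_eq; have /cls_eq h := cls_repr (cls f).
apply: sub_finite_set h => x /= [Ix e]; split=> // fx; apply: e.
by rewrite fx.
Qed.

Lemma fun_space_scaleA r s u :
  fun_space_scale r (fun_space_scale s u) = fun_space_scale (r * s) u.
Proof.
rewrite -[u]cls_repr !fun_space_scaleE; apply/cls_eq.
apply: sub_finite_set (ratfun_evalM r s) => x /= [_]; apply: contra_not => ->.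
by rewrite mulrA.
Qed.

Lemma fun_space_scale1 : left_id 1 fun_space_scale.
Proof.
move=> u; rewrite -[u]cls_repr fun_space_scaleE; apply/cls_eq.
apply: sub_finite_set ratfun_eval1 => x /= [_]; apply: contra_not => ->.
by rewrite mul1r.
Qed.

Lemma fun_space_scaleDr : right_distributive fun_space_scale +%R.
Proof.
move=> r u v; rewrite -[u]cls_repr -[v]cls_repr -clsD !fun_space_scaleE -clsD.
by congr cls; apply/funext => x; rewrite !fctE mulrDr.
Qed.

Lemma fun_space_scaleDl u :
  {morph fun_space_scale^~ u : r s / r + s}.
Proof.
move=> r s; rewrite -[u]cls_repr !fun_space_scaleE -clsD; apply/cls_eq.
apply: sub_finite_set (ratfun_evalD r s) => x /= [_]; apply: contra_not => h.
by rewrite fctE h mulrDl.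
Qed.

HB.instance Definition _ := GRing.Zmodule_isLmodule.Build {fraction {poly K}}
  fun_space fun_space_scaleA fun_space_scale1 fun_space_scaleDr fun_space_scaleDl.

End FunctionModule.

Inductive ground := GroundQ | GroundR | GroundC.

Definition complexes (R : realType) : numClosedFieldType := R[i].

Definition ground_field (R : realType) (g : ground) : fieldType :=
  match g with
  | GroundQ => rat
  | GroundR => R
  | GroundC => complexes R
  end.

Definition ground_emb (R : realType) (g : ground) :
    {rmorphism ground_field R g -> complexes R} :=
  match g with
  | GroundQ => (@ratr (complexes R) : {rmorphism rat -> complexes R})
  | GroundR => (@real_complex R : {rmorphism R -> R[i]})
  | GroundC => (idfun : {rmorphism complexes R -> complexes R})
  end.

(* Derivatives are taken relative to I: for I an interval of the real line
   (seen inside C) this is the derivative with respect to a real variable,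
   one-sided at the end points, and for I open in C it is the complex one. *)
Section RelativeDerivative.
Variables (C : numClosedFieldType) (I : set C).

Definition diff_quot (g : C -> C) (x y : C) : C := (g y - g x) / (y - x).

Definition derivable_on (g : C -> C) (x : C) : Prop :=
  cvg (diff_quot g x @ within I x^').

Definition deriv_on (g : C -> C) (x : C) : C :=
  lim (diff_quot g x @ within I x^').

Definition derivn_on (j : nat) (g : C -> C) : C -> C := iter j deriv_on g.

End RelativeDerivative.

Section Families.
Variables (R : realType) (g : ground).
Local Notation C := (complexes R).
Local Notation K := (ground_field R g).
Local Notation iota := (ground_emb R g).
Variables (D I : set C) (f : C -> C -> C).

Definition index_set : Prop :=
  (forall n, D n -> D (n + 1)) \/ (forall n, D n -> D (n - 1)).

(* Covers the nondegenerate real intervals (inside C) as well as the subsets of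
   C; isolated points are excluded since no derivative exists there. *)
Definition variable_set : Prop := I !=set0 /\ I `<=` limit_point I.

(* An equation is required at those n for which all the indices it involves
   belong to D. *)
Definition recurrence (m : nat) : Prop :=
  exists q : C -> nat -> {poly K},
    forall n, (forall k, (k <= m)%N -> D (n - k%:R)) ->
      [/\ q n 0%N <> 0, q n m <> 0 &
          forall x, I x -> \sum_(k < m.+1) poly_eval iota (q n k) x * f (n - k%:R) x = 0].

Definition backward_rule (M : nat) : Prop :=
  exists r : C -> nat -> {fraction {poly K}},
    forall n, (forall k, (k < M)%N -> D (n - k%:R)) ->
      cls iota I (deriv_on I (f n)) =
      \sum_(k < M) r n k *: cls iota I (f (n - k%:R)).

Definition forward_rule (M : nat) : Prop :=
  exists r : C -> nat -> {fraction {poly K}},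
    forall n, (forall k, (k < M)%N -> D (n + k%:R)) ->
      cls iota I (deriv_on I (f n)) =
      \sum_(k < M) r n k *: cls iota I (f (n + k%:R)).

Definition differentiable_family : Prop :=
  forall n x, D n -> I x -> derivable_on I (f n) x.

Definition derivative_rule : Prop :=
  differentiable_family /\
  exists2 M, (0 < M)%N & backward_rule M \/ forward_rule M.

Definition admissible (m : nat) : Prop := recurrence m /\ derivative_rule.

(* What is needed for the classes of all f_n^(j) to be meaningful: beyond the
   first derivative, finitely many exceptional points (such as poles of the
   r_k) are allowed. *)
Definition smooth_family : Prop :=
  differentiable_family /\
  forall n j, D n -> finite_set [set x | I x /\ ~ derivable_on I (derivn_on I j (f n)) x].

Definition shifted_derivatives (n : C) : set (fun_space iota I) :=
  [set v | exists (j k : nat) (l : C),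
     [/\ l = n + k%:R \/ l = n - k%:R, D l & v = cls iota I (derivn_on I j (f l))]].

Definition shift_space (n : C) : set (fun_space iota I) :=
  span (shifted_derivatives n).

(* An m-dimensional shift_space alone does not make f admissible of order m: for
   f_0 = 1 and f_n = 0 (n a nonzero integer) it has dimension 1, but q_0(0,x) f_0
   + q_1(0,x) f_(-1) = 0 forces q_0(0,x) = 0; for f_n = sin x it is spanned by sin
   and cos, but cos is no K(x)-multiple of sin.  When all dimensions are m,
   independence of m consecutive members is also necessary for admissibility. *)
Definition independent_shifts (m : nat) : Prop :=
  forall n, (forall k, (k < m)%N -> D (n - k%:R)) ->
    lin_indep (fun k : 'I_m => cls iota I (f (n - k%:R))).

End Families.

Arguments shifted_derivatives {R} g D I f n _.
Arguments shift_space {R} g D I f n _.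

(* Main.v *)
Require Import Defs.
From mathcomp Require Import all_boot all_order all_algebra.
From mathcomp Require Import generic_quotient ring_quotient fraction.
From mathcomp Require Import all_classical all_reals all_analysis.
From mathcomp Require Import ring zify.
Set Implicit Arguments.
Unset Strict Implicit.
Unset Printing Implicit Defensive.
Import Order.TTheory GRing.Theory Num.Theory numFieldNormedType.Exports.
(* The span of a finite sequence in a vector space would otherwise hide the span
   of a set. *)
Import Defs.
Local Open Scope classical_set_scope.
Local Open Scope ring_scope.

(** Suppose first that f is admissible of order m, and fix n in D.  The indices
    n + Z that lie in D form an interval unbounded in at least one direction.
    Both end coefficients of the recurrence are nonzero, so the recurrence can be
    read forwards and backwards; therefore a K(x)-subspace containing m
    consecutive members contains all members ([recurrence_propagates]).  This is
    used twice.

    It shows first that the span W of m consecutive members contains all members.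
    Secondly, the elements of W having a derivative in W form a K(x)-subspace,
    by the product rule and because K(x) is closed under differentiation
    ([deriv_stable_part_subspace]).  Far out in the unbounded direction the
    derivative rule applies and puts m consecutive members into this subspace; by
    propagation it contains all members, also those near an end of D where the
    derivative rule makes no assertion.  Hence W is stable under differentiation
    ([window_deriv_stable]).  It follows by induction that all higher derivatives
    exist up to finitely many points and have their classes in W, so that W is the
    shift space.  Being spanned by m vectors, it has dimension at most m.

    Suppose conversely that all shift spaces have dimension m and that m
    consecutive members are always independent.  Then m + 1 consecutive members
    are dependent, and independence of the first m and of the last m of them makes
    both end coefficients nonzero: this is a recurrence of order m between classes
    of functions, and it holds at every point because the functions are continuous
    and I has no isolated point ([finite_dim_recurrence]).  Moreover m consecutive
    members form a basis of the shift space, in which the derivative has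
    coordinates: this is a backward derivative rule
    ([finite_dim_backward_rule]). *)

(** * Linear algebra of spans *)

Section LinearAlgebra.
Variables (F : fieldType) (V : lmodType F).
Implicit Types (S W : set V) (u v : V).

Definition subspace W : Prop :=
  W 0 /\ forall a u v, W u -> W v -> W (a *: u + v).

Lemma subspaceZ W a u : subspace W -> W u -> W (a *: u).
Proof. by move=> [W0 WD] Wu; rewrite -[_ *: _]addr0; apply: WD. Qed.

Lemma subspace_sum W (T : Type) (r : seq T) (P : pred T) (h : T -> V) :
  subspace W -> (forall i, P i -> W (h i)) -> W (\sum_(i <- r | P i) h i).
Proof.
move=> [W0 WD] Wh; elim/big_rec: _ => [//|i x Pi Wx].
by rewrite -[h i]scale1r; apply: WD => //; apply: Wh.
Qed.

Lemma span_le S W : subspace W -> S `<=` W -> span S `<=` W.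
Proof.
move=> sW SW _ [d [a [s [Ss ->]]]]; apply: subspace_sum => // i _.
by apply: subspaceZ => //; apply: SW.
Qed.

Lemma span_incl S : S `<=` span S.
Proof.
move=> v Sv; exists 1%N, (fun=> 1), (fun=> v); split=> //.
by rewrite big_ord1 scale1r.
Qed.

Lemma span_subspace S : subspace (span S).
Proof.
split; first by exists 0%N, (fun=> 0), (fun=> 0); split=> [[]//|]; rewrite big_ord0.
move=> c u v [d [a [s [Ss ->]]]] [d' [a' [s' [Ss' ->]]]].
exists (d + d')%N,
  (fun i => match fintype.split i with inl j => c * a j | inr j => a' j end),
  (fun i => match fintype.split i with inl j => s j | inr j => s' j end).
split=> [i|]; first by case: fintype.split.
rewrite big_split_ord /= scaler_sumr; congr (_ + _); apply: eq_bigr => i _.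
  by rewrite (unsplitK (inl i)) scalerA.
by rewrite (unsplitK (inr i)).
Qed.

Lemma span_rangeP (d : nat) (b : 'I_d -> V) v :
  span (range b) v <-> exists a : 'I_d -> F, v = \sum_(i < d) a i *: b i.
Proof.
split=> [|[a ->]]; last first.
  apply: subspace_sum => [|i _]; first exact: span_subspace.
  by apply: subspaceZ; [exact: span_subspace|apply: span_incl; exists i].
move: v; apply: span_le => [|_ [i _ <-]]; last first.
  exists (fun j => (j == i)%:R); rewrite (bigD1 i) //= eqxx scale1r.
  by rewrite big1 ?addr0 // => j /negbTE ->; rewrite scale0r.
split=> [|c _ _ [a ->] [a' ->]].
  by exists (fun=> 0); rewrite big1 // => i _; rewrite scale0r.
exists (fun i => c * a i + a' i); rewrite scaler_sumr -big_split /=.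
by apply: eq_bigr => i _; rewrite scalerDl scalerA.
Qed.

Lemma subspace_solve W (d : nat) (a : 'I_d -> F) (v : 'I_d -> V) (j : 'I_d) :
  subspace W -> \sum_(i < d) a i *: v i = 0 -> a j != 0 ->
  (forall i, i != j -> W (v i)) -> W (v j).
Proof.
move=> sW; rewrite (bigD1 j) //= => /eqP; rewrite addr_eq0 => /eqP av aj Wv.
rewrite -[v j](scalerK aj) av; apply: subspaceZ => //.
rewrite -scaleN1r; apply: subspaceZ => //; apply: subspace_sum => // i ij.
by apply: subspaceZ => //; exact: Wv.
Qed.

(** A dependent spanning family may drop a vector with a nonzero coefficient in
    some relation; repeating this ends with a basis. *)
Lemma span_range_dim_le (d : nat) (b : 'I_d -> V) : dim_le (span (range b)) d.
Proof.
elim: d b => [|d IH] b; first by exists 0%N => //; exists b; split=> // a _ [].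
have [ib|] := pselect (lin_indep b); first by exists d.+1 => //; exists b.
move=> /existsNP[a /not_implyP[ab /existsNP[i /eqP ai]]].
suff E : span (range b) = span (range (b \o lift i)).
  have [d' d'd hd'] := IH (b \o lift i).
  by exists d'; [exact: leqW|rewrite E].
have lift_in k : span (range (b \o lift i)) (b (lift i k)).
  by apply: span_incl; exists k.
apply/seteqP; split; apply: span_le; try exact: span_subspace.
  move=> _ [j _ <-]; have [k -> //|->] := unliftP i j.
  apply: (subspace_solve (span_subspace _) ab ai) => j' ij'.
  by have [k -> //|j'i] := unliftP i j'; rewrite j'i eqxx in ij'.
by move=> _ [k _ <-]; apply: span_incl; exists (lift i k).
Qed.

(** The coordinates form a matrix with more rows than columns, and a vector of
    its left kernel is a relation. *)
Lemma has_dim_dependent W (d : nat) (v : 'I_d.+1 -> V) :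
  has_dim W d -> (forall i, W (v i)) -> ~ lin_indep v.
Proof.
move=> [b [_ ->]] Wv iv.
have /choice[A vE] i : exists a : 'I_d -> F, v i = \sum_(j < d) a j *: b j.
  exact/span_rangeP/Wv.
pose M := \matrix_(i < d.+1, j < d) A i j.
have : kermx M != 0.
  rewrite kermx_eq0 /row_free neq_ltn (leq_trans (_ : (\rank M < d.+1)%N)) //.
  by rewrite ltnS rank_leq_col.
move=> /rowV0Pn[w /sub_kermxP wM /eqP w0]; apply: w0; apply/rowP => i.
rewrite mxE; apply: (iv (w 0)) => {i}.
transitivity (\sum_(j < d) (w *m M) 0 j *: b j); last first.
  by rewrite big1 // => j _; rewrite wM mxE scale0r.
under [RHS]eq_bigr => j _ do rewrite mxE scaler_suml.
rewrite exchange_big /=; apply: eq_bigr => i _; rewrite vE scaler_sumr.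
by apply: eq_bigr => j _; rewrite mxE scalerA.
Qed.

(** A relation whose j-th coefficient vanished would be a relation between the
    other vectors. *)
Lemma coef_neq0 (d : nat) (a : 'I_d.+1 -> F) (v : 'I_d.+1 -> V) (i j : 'I_d.+1) :
  lin_indep (v \o lift j) -> \sum_(i < d.+1) a i *: v i = 0 -> a i != 0 ->
  a j != 0.
Proof.
move=> iv av; apply: contraNneq => aj.
move: av; rewrite (bigD1_ord j) //= aj scale0r add0r => /(iv (a \o lift j)) a0.
by apply/eqP; have [k ->|->] := unliftP j i; [exact: a0|].
Qed.

(** Adjoining one more vector of W to b makes a dependent family, and in a
    relation for it the new vector has a nonzero coefficient because b is
    independent. *)
Lemma has_dim_indep_spans W (d : nat) (b : 'I_d -> V) :
  has_dim W d -> (forall i, W (b i)) -> lin_indep b -> W `<=` span (range b).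
Proof.
move=> dW Wb ib w Ww.
pose v (i : 'I_d.+1) := if unlift ord_max i is Some j then b j else w.
have vl : v \o lift ord_max = b by apply/funext => j; rewrite /v /= liftK.
have vw : v ord_max = w by rewrite /v unlift_none.
have /(has_dim_dependent dW) : forall i, W (v i) by move=> i; rewrite /v; case: unlift.
move=> /existsNP[a /not_implyP[av /existsNP[i /eqP ai]]].
have amax : a ord_max != 0 by apply: coef_neq0 av ai; rewrite vl.
rewrite -vw; apply: (subspace_solve (span_subspace _) av amax) => j jmax.
have [k ->|jE] := unliftP ord_max j; last by rewrite jE eqxx in jmax.
by apply: span_incl; exists k => //; rewrite -vl.
Qed.

End LinearAlgebra.

(** * Derivatives relative to a set *)

Section RelativeDerivatives.
Variables (C : numClosedFieldType) (I : set C).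
Implicit Types (f h : C -> C) (x l : C).

(** The derivative as a relation: the rules of calculus need no side condition
    on the existence of limits, and uniqueness is only used where x is a limit
    point of I. *)
Definition has_deriv f x l : Prop := diff_quot f x @ within I x^' --> l.

Lemma limit_point_proper x : limit_point I x -> ProperFilter (within I x^').
Proof.
move=> lx; apply: Build_ProperFilter_ex => P.
rewrite /within /= /dnbhs /within /= => xP.
have [y [yx Iy Py]] := lx _ xP.
by exists y; apply: Py.
Qed.

Lemma near_within_neq x : \forall y \near within I x^', y != x.
Proof. by rewrite /within /= /dnbhs /within /=; apply: (@filterE _ (nbhs x)). Qed.

(** A finite set without x is closed, and x itself is left out of the filter. *)
Lemma near_within_avoid x (B : set C) :
  finite_set B -> \forall y \near within I x^', ~ B y.
Proof.
move=> fB; have cB : closed (B `\ x).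
  have := @accessible_finite_set_closed C.
  move=> [/(_ (hausdorff_accessible (@norm_hausdorff _ C))) h _]; apply: h.
  exact: finite_setD.
have : nbhs x (~` (B `\ x)).
  by apply: open_nbhs_nbhs; split; [exact: closed_openC|move=> /= [_]; apply].
rewrite /within /= /dnbhs /within /=; apply: filterS => y /= nB yx _ By.
by apply: nB; split=> // e; move: yx; rewrite e eqxx.
Qed.

(** At a point outside the finite exceptional set the two functions agree in a
    whole neighbourhood, so differentiation is well defined on classes. *)
Lemma has_deriv_eq f h x l (B : set C) :
  finite_set B -> I x -> ~ B x -> (forall y, I y -> ~ B y -> f y = h y) ->
  has_deriv f x l -> has_deriv h x l.
Proof.
move=> fB Ix Bx fh; apply: cvg_trans; apply: near_eq_cvg.
have Inear : \forall y \near within I x^', I y by exact: withinT.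
near=> y; have Iy : I y by near: y.
have By : ~ B y by near: y; exact: near_within_avoid.
by rewrite /diff_quot !fh.
Unshelve. all: by end_near. Qed.

Lemma has_deriv_cvg f x l : has_deriv f x l -> f @ within I x^' --> f x.
Proof.
move=> fl.
have idx : (fun y : C => y) @ within I x^' --> x.
  by move=> A xA; rewrite /within /dnbhs /within /=; apply: filterS xA.
have : (fun y => f x + (y - x) * diff_quot f x y) @ within I x^' --> f x + (x - x) * l.
  apply: cvgD; first exact: cvg_cst.
  by apply: cvgM => //; apply: cvgB => //; exact: cvg_cst.
rewrite subrr mul0r addr0; apply: cvg_trans; apply: near_eq_cvg; near=> y.
have yx : y - x != 0 by rewrite subr_eq0; near: y; exact: near_within_neq.
by rewrite /diff_quot mulrC divfK // addrC subrK.
Unshelve. all: by end_near. Qed.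

Lemma has_deriv_cst (c : C) x : has_deriv (fun=> c) x 0.
Proof.
have : (fun=> 0 : C) @ within I x^' --> (0 : C) by exact: cvg_cst.
apply: cvg_trans; apply: near_eq_cvg; apply: filterE => y.
by rewrite /diff_quot subrr mul0r.
Qed.

Lemma has_deriv_id x : has_deriv id x 1.
Proof.
have : (fun=> 1 : C) @ within I x^' --> (1 : C) by exact: cvg_cst.
apply: cvg_trans; apply: near_eq_cvg; near=> y.
have yx : y - x != 0 by rewrite subr_eq0; near: y; exact: near_within_neq.
by rewrite /diff_quot divff.
Unshelve. all: by end_near. Qed.

Lemma has_derivD f h x l l' : has_deriv f x l -> has_deriv h x l' ->
  has_deriv (fun y => f y + h y) x (l + l').
Proof.
move=> fl hl; apply: cvg_trans (cvgD fl hl); apply: near_eq_cvg.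
apply: filterE => y; rewrite /diff_quot fctE.
by rewrite -mulrDl opprD addrACA.
Qed.

Lemma has_deriv_sum (n : nat) (h : 'I_n -> C -> C) x (l : 'I_n -> C) :
  (forall i, has_deriv (h i) x (l i)) ->
  has_deriv (fun y => \sum_(i < n) h i y) x (\sum_(i < n) l i).
Proof.
elim: n h l => [|n IH] h l hl.
  rewrite big_ord0 (_ : (fun _ => _) = fun=> 0); first exact: has_deriv_cst.
  by apply/funext => y; rewrite big_ord0.
rewrite big_ord_recr (_ : (fun _ => _) =
  fun y => \sum_(i < n) h (widen_ord (leqnSn n) i) y + h ord_max y).
  by apply: has_derivD => //; apply: IH.
by apply/funext => y; rewrite big_ord_recr.
Qed.

Lemma has_derivM f h x l l' : has_deriv f x l -> has_deriv h x l' ->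
  has_deriv (fun y => f y * h y) x (l * h x + f x * l').
Proof.
move=> fl hl; have hc := has_deriv_cvg hl.
have fc : (fun=> f x) @ within I x^' --> f x by exact: cvg_cst.
(* f y h y - f x h x = (f y - f x) h y + f x (h y - h x) *)
apply: cvg_trans (cvgD (cvgM fl hc) (cvgM fc hl)); apply: near_eq_cvg.
apply: filterE => y; rewrite /diff_quot /= !fctE /=; set c := (y - x)^-1.
ring.
Qed.

Lemma has_derivV f x l : f x != 0 -> has_deriv f x l ->
  has_deriv (fun y => (f y)^-1) x (- l / f x ^+ 2).
Proof.
move=> fx0 fl; have fc := has_deriv_cvg fl.
have cf : (fun=> - (f x)^-1) @ within I x^' --> - (f x)^-1 by exact: cvg_cst.
have -> : - l / f x ^+ 2 = - (f x)^-1 * (l * (f x)^-1) by field.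
apply: cvg_trans (cvgM cf (cvgM fl (cvgV fx0 fc))); apply: near_eq_cvg.
have fy : \forall y \near within I x^', f y != 0 by exact: cvgr_neq0 fc fx0.
near=> y; have fy0 : f y != 0 by near: y.
rewrite /diff_quot /=.
have yx : y - x != 0 by rewrite subr_eq0; near: y; exact: near_within_neq.
by field; rewrite fx0 fy0 yx.
Unshelve. all: by end_near. Qed.

Lemma has_deriv_horner (p : {poly C}) x : has_deriv (horner p) x p^`().[x].
Proof.
elim/poly_ind: p => [|p c IH].
  rewrite deriv0 horner0.
  rewrite (_ : horner 0 = fun=> 0); first exact: has_deriv_cst.
  by apply/funext => y; rewrite horner0.
have -> : horner (p * 'X + c%:P) = fun y => p.[y] * y + c.
  by apply/funext => y; rewrite !hornerE.
rewrite derivD derivM derivX derivC !hornerE.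
have := has_derivD (has_derivM IH (@has_deriv_id x)) (has_deriv_cst c x).
by rewrite addr0 mulr1 addrC.
Qed.

(** At a limit point of I the limit defining [deriv_on] is unique, so the total
    function and the relation say the same. *)
Lemma derivable_onP f x l : limit_point I x ->
  has_deriv f x l <-> derivable_on I f x /\ deriv_on I f x = l.
Proof.
move=> lx; have pF := limit_point_proper lx; split=> [fl|[df <-]] //.
split; first by apply/cvg_ex; exists l.
exact/cvg_lim/fl/norm_hausdorff.
Qed.

End RelativeDerivatives.

(** * Differentiation of classes *)

Section ClassDerivative.
Variables (K : fieldType) (C : numClosedFieldType) (iota : {rmorphism K -> C}).
Variable I : set C.
Local Notation Kx := {fraction {poly K}}.
Local Notation "x %:F" := (@FracField.tofrac {poly K} x).
Local Notation cls := (cls iota I).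
Implicit Types (f h : C -> C) (u v : fun_space iota I) (r : Kx).

Lemma scale_cls r f : r *: cls f = cls (fun x => ratfun_eval iota r x * f x).
Proof. exact: fun_space_scaleE. Qed.

Lemma cls0 : cls (fun=> 0) = 0.
Proof.
apply: (addrI (cls (fun=> 0))); rewrite addr0 -clsD; congr cls.
by apply/funext => x; rewrite fctE addr0.
Qed.

Lemma cls_sum (n : nat) (F : 'I_n -> C -> C) :
  cls (fun x => \sum_(i < n) F i x) = \sum_(i < n) cls (F i).
Proof.
elim: n F => [|n IH] F.
  rewrite big_ord0 -cls0; congr cls; apply/funext => x; exact: big_ord0.
rewrite big_ord_recr /= -IH -clsD; congr cls; apply/funext => x.
by rewrite big_ord_recr.
Qed.

Lemma ratfun_eval_pi_finite (a : {ratio {poly K}}) :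
  finite_set [set x | ratfun_eval iota (\pi_Kx%qT a) x <>
    poly_eval iota (frac a).1 x / poly_eval iota (frac a).2 x].
Proof.
apply: (sub_finite_set (B := [set x | poly_eval iota (frac a).2 x = 0] `|`
  [set x | poly_eval iota (frac (repr (\pi_Kx%qT a))).2 x = 0])); last first.
  by rewrite finite_setU; split; exact: finite_denom_zeros.
move=> x /=; apply: contra_notP => /not_orP[da dr].
exact: ratfun_eval_pi.
Qed.

Lemma ratfun_eval_tofrac (p : {poly K}) :
  finite_set [set x | ratfun_eval iota (p%:F) x <> poly_eval iota p x].
Proof.
apply: sub_finite_set (ratfun_eval_pi_finite (Ratio p 1)) => x /=.
apply: contra_not; rewrite /FracField.tofrac -lock => ->.
by rewrite numer_Ratio ?denom_Ratio ?oner_neq0 // poly_eval1 divr1.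
Qed.

Lemma scale_tofrac_cls (p : {poly K}) f :
  p%:F *: cls f = cls (fun x => poly_eval iota p x * f x).
Proof.
rewrite scale_cls; apply/cls_eq; apply: sub_finite_set (ratfun_eval_tofrac p).
by move=> x /= [_]; apply: contra_not => ->.
Qed.

(** A derivation on the space of classes is only partially defined, hence a
    relation.  Allowing a finite exceptional set makes it independent of the
    representatives, see [class_deriv_cls]. *)
Definition class_deriv u v : Prop := exists f h,
  [/\ cls f = u, cls h = v & finite_set [set x | I x /\ ~ has_deriv I f x (h x)]].

Lemma class_deriv_cls f h : class_deriv (cls f) (cls h) <->
  finite_set [set x | I x /\ ~ has_deriv I f x (h x)].
Proof.
split=> [[f0 [h0 [/cls_eq ff0 /cls_eq hh0 fh0]]]|]; last by exists f, h.
set Bf := [set x | _] in ff0; set Bh := [set x | _] in hh0.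
set B := [set x | _] in fh0.
apply: (sub_finite_set (B := Bf `|` (Bh `|` B))); last by rewrite !finite_setU.
move=> x /= [Ix]; apply: contra_notP => /not_orP[nf /not_orP[nh nB]].
have <- : h0 x = h x by apply: contrapT => ?; apply: nh; split.
apply: (has_deriv_eq (f := f0) ff0 Ix nf) => [y Iy nBf|]; last first.
  by apply: contrapT => ?; apply: nB; split.
by apply: contrapT => ?; apply: nBf; split.
Qed.

Lemma class_derivD u u' v v' : class_deriv u v -> class_deriv u' v' ->
  class_deriv (u + u') (v + v').
Proof.
move=> [f [h [<- <- fh]]] [f' [h' [<- <- fh']]]; rewrite -!clsD.
apply/class_deriv_cls; set B := [set x | _] in fh; set B' := [set x | _] in fh'.
apply: (sub_finite_set (B := B `|` B')); last by rewrite finite_setU.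
move=> x /= [Ix]; apply: contra_notP => /not_orP[nB nB'].
apply: has_derivD; first by apply: contrapT => ?; apply: nB; split.
by apply: contrapT => ?; apply: nB'; split.
Qed.

(** The derivative of a rational function is again the evaluation of an element
    of K(x), by the quotient rule applied to the chosen representative. *)
Lemma ratfun_deriv r : exists r' : Kx, finite_set
  [set x | ~ has_deriv I (ratfun_eval iota r) x (ratfun_eval iota r' x)].
Proof.
set p := (frac (repr r)).1; set q := (frac (repr r)).2.
have q0 : q != 0 by exact: denom_ratioP.
pose a := Ratio (p^`() * q - p * q^`()) (q ^+ 2).
exists (\pi_Kx%qT a).
apply: (sub_finite_set (B := [set x | poly_eval iota q x = 0] `|` [set x |
  ratfun_eval iota (\pi_Kx%qT a) x <>
  poly_eval iota (frac a).1 x / poly_eval iota (frac a).2 x])).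
  move=> x /=; apply: contra_notP => /not_orP[/eqP qx nB].
  have -> : ratfun_eval iota (\pi_Kx%qT a) x =
            poly_eval iota (frac a).1 x / poly_eval iota (frac a).2 x.
    by apply: contrapT => ?; apply: nB.
  rewrite numer_Ratio ?denom_Ratio ?expf_neq0 //.
  have poly_deriv s : has_deriv I (poly_eval iota s) x (poly_eval iota s^`() x).
    by rewrite /poly_eval -deriv_map; exact: has_deriv_horner.
  have := has_derivM (poly_deriv p) (has_derivV qx (poly_deriv q)).
  rewrite /has_deriv; congr (_ --> _).
  rewrite (expr2 q) -mulNr poly_evalD !poly_evalM.
  rewrite (_ : poly_eval iota (- p) x = - poly_eval iota p x).
    by field.
  by rewrite /poly_eval rmorphN hornerN.
rewrite finite_setU; split; last exact: ratfun_eval_pi_finite.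
exact: finite_poly_zeros.
Qed.

(** The product rule; the multiplier r' is the derivative of r and does not depend
    on the class differentiated. *)
Lemma class_derivZ r : exists r' : Kx, forall u v,
  class_deriv u v -> class_deriv (r *: u) (r' *: u + r *: v).
Proof.
have [r' rr'] := ratfun_deriv r; exists r' => _ _ [f [h [<- <- fh]]].
rewrite !scale_cls -clsD; apply/class_deriv_cls.
set B := [set x | _] in fh; set B' := [set x | _] in rr'.
apply: (sub_finite_set (B := B `|` B')); last by rewrite finite_setU.
move=> x /= [Ix]; apply: contra_notP => /not_orP[nB nB']; rewrite fctE.
apply: has_derivM; last by apply: contrapT => ?; apply: nB; split.
by apply: contrapT => ?; apply: nB'.
Qed.

Definition deriv_stable_part (W : set (fun_space iota I)) :=
  [set u | W u /\ exists2 v, W v & class_deriv u v].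

(** Because of the product rule, closure under multiplication by r needs W to be
    closed under K(x), not just under constants. *)
Lemma deriv_stable_part_subspace W :
  subspace W -> subspace (deriv_stable_part W).
Proof.
case=> W0 WD; split.
  split=> //; exists 0 => //; rewrite -cls0; apply/class_deriv_cls.
  apply: (sub_finite_set _ (finite_set0 C)) => x /= [_]; apply.
  exact: has_deriv_cst.
move=> r u u' [Wu [v Wv uv]] [Wu' [v' Wv' uv']]; split; first exact: WD.
have [r' rr'] := class_derivZ r.
exists (r' *: u + (r *: v + v')).
  by apply: (WD) => //; exact: WD.
by rewrite addrA; apply: class_derivD => //; exact: rr'.
Qed.

Hypothesis I_limit : I `<=` limit_point I.

Lemma class_deriv_deriv_on f v : class_deriv (cls f) v ->
  finite_set [set x | I x /\ ~ derivable_on I f x] /\ cls (deriv_on I f) = v.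
Proof.
rewrite -[v]cls_repr => /class_deriv_cls fv; split.
  apply: sub_finite_set fv => x /= [Ix nd]; split=> // fx; apply: nd.
  by have /derivable_onP[] := fx; first exact: I_limit.
apply/cls_eq; apply: sub_finite_set fv => x /= [Ix nd]; split=> // fx; apply: nd.
by have /derivable_onP[] := fx; first exact: I_limit.
Qed.

Lemma derivable_on_class_deriv f : (forall x, I x -> derivable_on I f x) ->
  class_deriv (cls f) (cls (deriv_on I f)).
Proof.
move=> df; apply/class_deriv_cls.
apply: (sub_finite_set _ (finite_set0 C)) => x /= [Ix]; apply.
by apply/derivable_onP; [exact: I_limit|split=> //; exact: df].
Qed.

(** That the j-th derivative has its class in W is what makes it differentiable off
    a finite set, so membership and differentiability go up together. *)
Lemma derivn_on_stable (W : set (fun_space iota I)) f :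
  W `<=` deriv_stable_part W -> W (cls f) -> forall j,
  W (cls (derivn_on I j f)) /\
  finite_set [set x | I x /\ ~ derivable_on I (derivn_on I j f) x].
Proof.
move=> sW Wf; elim=> [|j [Wj _]].
  by split=> //; have [_ [v _ /class_deriv_deriv_on[]]] := sW _ Wf.
suff Wj1 : W (cls (derivn_on I j.+1 f)).
  by split=> //; have [_ [v _ /class_deriv_deriv_on[]]] := sW _ Wj1.
by have [_ [v Wv /class_deriv_deriv_on[_ E]]] := sW _ Wj; rewrite /derivn_on iterS E.
Qed.

(** Every point of I is a limit of points of I where f vanishes, since finitely
    many exceptional points can be avoided; continuity does the rest. *)
Lemma cls_eq0_continuous f : (forall x, I x -> f @ within I x^' --> f x) ->
  cls f = 0 -> forall x, I x -> f x = 0.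
Proof.
move=> cf; rewrite -cls0 => /cls_eq f0 x Ix.
have pF := limit_point_proper (I_limit Ix).
have c0 : (fun=> 0 : C) @ within I x^' --> (0 : C) by exact: cvg_cst.
apply: (cvg_unique (@norm_hausdorff _ C) (cf x Ix)).
apply: cvg_trans c0; apply: near_eq_cvg; near=> y.
have Iy : I y by near: y; exact: withinT.
have nB : ~ [set x | I x /\ f x <> 0] y by near: y; exact: near_within_avoid.
by apply/esym; apply: contra_notP nB => ?; split.
Unshelve. all: by end_near. Qed.

End ClassDerivative.

(** * Denominators in a field of fractions *)

Lemma tofrac_den_mul (R : idomainType) (x : {fraction R}) :
  FracField.tofrac (frac (repr x)).2 * x = FracField.tofrac (frac (repr x)).1.
Proof.
set b := repr x; rewrite -[in LHS](reprK x) -/b /FracField.tofrac -!lock.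
rewrite -[LHS](FracField.pi_mul (Ratio (frac b).2 1) b).
apply/eqmodP => /=; rewrite FracField.equivfE /FracField.mulf.
have b0 : (frac b).2 != 0 by exact: denom_ratioP.
by rewrite !numden_Ratio ?mul1r ?oner_neq0 // mulr1.
Qed.

Lemma common_denominator (R : idomainType) (n : nat) (a : 'I_n -> {fraction R}) :
  exists2 d : R, d != 0 & exists p : 'I_n -> R, forall i,
    FracField.tofrac (p i) = FracField.tofrac d * a i.
Proof.
pose nu i := (frac (repr (a i))).1; pose de i := (frac (repr (a i))).2.
exists (\prod_i de i); first by apply/prodf_neq0 => i _; exact: denom_ratioP.
exists (fun i => nu i * \prod_(j | j != i) de j) => i.
by rewrite [in RHS](bigD1 i) //= !tofracM [RHS]mulrAC tofrac_den_mul.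
Qed.

(** * Two-sided propagation along a recurrence *)

Section Propagation.
Variables (F : fieldType) (V : lmodType F) (P : int -> Prop) (e : int -> V).
Variable m : nat.
Hypothesis P_up : forall z, P z -> P (z + 1).
Hypothesis rec_e : forall z, P z -> exists a : nat -> F,
  [/\ a 0%N != 0, a m != 0 & \sum_(k < m.+1) a k *: e (z + k%:Z) = 0].

Lemma up_closedD z (k : nat) : P z -> P (z + k%:Z).
Proof.
by elim: k => [|k IH] Pz; rewrite ?addr0 // -addn1 PoszD addrA; exact/P_up/IH.
Qed.

(** The two end coefficients do not vanish, so the recurrence expresses either end
    value by the others: membership spreads upwards by the last coefficient,
    and downwards, as far as P reaches, by the first. *)
Lemma recurrence_propagates (W : set V) z0 : subspace W -> P z0 ->
  (forall k, (k < m)%N -> W (e (z0 + k%:Z))) -> forall z, P z -> W (e z).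
Proof.
move=> sW Pz0 We.
have up k : W (e (z0 + k%:Z)).
  elim/ltn_ind: k => k IH; have [/We//|mk] := ltnP k m.
  have [a [_ am ea]] := rec_e (up_closedD (k - m) Pz0).
  have -> : z0 + k%:Z = z0 + (k - m)%N%:Z + (ord_max : 'I_m.+1)%:Z.
    by rewrite -addrA -PoszD /= subnK.
  apply: (subspace_solve (a := fun i : 'I_m.+1 => a i)
    (v := fun i : 'I_m.+1 => e (z0 + (k - m)%N%:Z + i%:Z)) (j := ord_max)
    sW ea am) => i im.
  rewrite -addrA -PoszD; apply: IH.
  have : (i < m)%N by rewrite ltn_neqAle -ltnS ltn_ord andbT.
  lia.
have down k : P (z0 - k%:Z) -> W (e (z0 - k%:Z)).
  elim/ltn_ind: k => k IH Pk.
  have [a [a0 _ ea]] := rec_e Pk.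
  have -> : z0 - k%:Z = z0 - k%:Z + (ord0 : 'I_m.+1)%:Z by rewrite addr0.
  apply: (subspace_solve (a := fun i : 'I_m.+1 => a i)
    (v := fun i : 'I_m.+1 => e (z0 - k%:Z + i%:Z)) (j := ord0) sW ea a0) => i i0.
  have {}i0 : (0 < i)%N by rewrite lt0n.
  have [ki|ik] := leqP k i.
    have -> : z0 - k%:Z + i%:Z = z0 + (i - k)%N%:Z by lia.
    exact: up.
  have Pi := up_closedD i Pk; move: Pi.
  have -> : z0 - k%:Z + i%:Z = z0 - (k - i)%N%:Z by lia.
  by apply: IH; lia.
move=> z Pz; have [zz|zz] := leP z0 z.
  have -> : z = z0 + `|z - z0|%N%:Z by lia.
  exact: up.
have zE : z = z0 - `|z - z0|%N%:Z by lia.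
by rewrite zE; apply: down; rewrite -zE.
Qed.

End Propagation.

(** * Admissible families *)

Section AdmissibleFamilies.
Variables (R : realType) (g : ground).
Local Notation C := (complexes R).
Local Notation K := (ground_field R g).
Local Notation iota := (ground_emb R g).
Local Notation Kx := {fraction {poly K}}.
Local Notation "x %:F" := (@FracField.tofrac {poly K} x).
Variables (D I : set C) (f : C -> C -> C) (m : nat).
Local Notation cls := (cls iota I).
Hypothesis I_limit : I `<=` limit_point I.

Lemma cls_recurrence (q : nat -> {poly K}) (h : nat -> C -> C) :
  (forall x, I x -> \sum_(k < m.+1) poly_eval iota (q k) x * h k x = 0) ->
  \sum_(k < m.+1) (q k)%:F *: cls (h k) = 0.
Proof.
move=> qh; under eq_bigr => k _ do rewrite scale_tofrac_cls.
rewrite -(cls_sum iota I (fun (k : 'I_m.+1) x => poly_eval iota (q k) x * h k x)).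
rewrite -(cls0 iota I); apply/cls_eq.
by apply: (sub_finite_set _ (finite_set0 C)) => x /= [/qh qx]; apply.
Qed.

Section Chain.
Variables (n s : C).
Hypothesis Dn : D n.
Hypothesis s_unit : s = 1 \/ s = - 1.
Hypothesis D_up : forall l, D l -> D (l + s).

(** Numbering the indices n + Z in the direction in which D is closed lets both
    kinds of D, and both directions of the derivative rule, share one proof:
    D becomes an upward closed set of integers containing 0. *)
Definition chain (z : int) : C := n + s * z%:~R.
Let P z := D (chain z).
Let e z := cls (f (chain z)).

Lemma chain_up z : P z -> P (z + 1).
Proof. by rewrite /P /chain intrD mulrDr mulr1 addrA; exact: D_up. Qed.

Lemma chain_nonneg z : 0 <= z -> P z.
Proof.
case: z => // k _; rewrite -[Posz k]add0r; apply: (up_closedD (P := P) chain_up).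
by rewrite /P /chain mulr0 addr0.
Qed.

Lemma chain_shift z (k : nat) (l : C) :
  l = chain z + k%:R \/ l = chain z - k%:R -> exists2 z', l = chain z' & z - k%:Z <= z'.
Proof.
rewrite /chain; case=> ->; case: s_unit => ->; rewrite ?mul1r ?mulN1r.
- by exists (z + k%:Z); [rewrite intrD; ring|lia].
- by exists (z - k%:Z); [rewrite intrB; ring|lia].
- by exists (z - k%:Z); [rewrite intrB; ring|lia].
- by exists (z + k%:Z); [rewrite intrD; ring|lia].
Qed.

(** When the numbering runs upwards the coefficients have to be reversed, because
    the recurrence is written with the shifts n - k. *)
Lemma chain_recurrence : recurrence g D I f m -> forall z, P z ->
  exists a : nat -> Kx,
    [/\ a 0%N != 0, a m != 0 & \sum_(k < m.+1) a k *: e (z + k%:Z) = 0].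
Proof.
move=> [q qP] z Pz.
have DP k : D (chain (z + k%:Z)) by exact: (up_closedD (P := P) chain_up).
have [s1|s1] := s_unit.
  have nk k : (k <= m)%N -> chain (z + m%:Z) - k%:R = chain (z + (m - k)%N%:Z).
    move=> km; rewrite /chain s1 !mul1r -addrA; congr (_ + _).
    by rewrite -subzn // !rmorphD rmorphN /= addrA.
  have [k km|q0 qm qf] := qP (chain (z + m%:Z)); first by rewrite nk.
  exists (fun k => (q (chain (z + m%:Z)) (m - k)%N)%:F).
  rewrite subn0 subnn !tofrac_eq0; split; [exact/eqP|exact/eqP|].
  rewrite -[RHS](cls_recurrence
    (h := fun k => f (chain (z + m%:Z) - k%:R)) qf).
  rewrite (reindex_inj rev_ord_inj) /=.
  apply: eq_bigr => k _; have km : (k <= m)%N by rewrite -ltnS.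
  by rewrite subSS (subKn km) (nk k km).
have nk k : chain z - k%:R = chain (z + k%:Z).
  by rewrite /chain s1 !mulN1r intrD opprD addrA.
have [k km|q0 qm qf] := qP (chain z); first by rewrite nk.
exists (fun k => (q (chain z) k)%:F).
rewrite !tofrac_eq0; split; [exact/eqP|exact/eqP|].
rewrite -[RHS](cls_recurrence (h := fun k => f (chain z - k%:R)) qf).
by apply: eq_bigr => k _; rewrite (nk k).
Qed.

Hypothesis f_adm : admissible g D I f m.

(** The span of the first m members from n on; it will turn out to be the whole
    shift space. *)
Let W : set (fun_space iota I) := span (range (fun k : 'I_m => e k%:Z)).

Lemma chain_in_window z : P z -> W (e z).
Proof.
have [f_rec _] := f_adm.
apply: (recurrence_propagates (P := P) (e := e) chain_up
  (chain_recurrence f_rec) (z0 := 0)).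
- exact: span_subspace.
- exact: chain_nonneg.
- by move=> k km; apply: span_incl; exists (Ordinal km) => //; rewrite add0r.
Qed.

(** From the position M on the derivative rule applies, whatever its direction,
    since all shifts by less than M stay in the chain.  Near an end of D the rule
    may say nothing; there the members are K(x)-combinations of later ones, and
    having a derivative in W is a property stable under such combinations. *)
Lemma window_deriv_stable : W `<=` deriv_stable_part W.
Proof.
have [f_rec [f_diff [M M0 ruleM]]] := f_adm.
have rule z : M%:Z <= z -> W (cls (deriv_on I (f (chain z)))).
  move=> Mz.
  have near_chain k l : (k < M)%N -> l = chain z + k%:R \/ l = chain z - k%:R ->
      D l /\ W (cls (f l)).
    move=> kM /chain_shift[z' -> zz']; have Pz' : P z' by apply: chain_nonneg; lia.
    by split=> //; exact: chain_in_window.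
  have [[r rP]|[r rP]] := ruleM; rewrite rP.
  - apply: subspace_sum; first exact: span_subspace.
    move=> k _; apply: subspaceZ; first exact: span_subspace.
    by have [] := near_chain k _ (ltn_ord k) (or_intror erefl).
  - by move=> k kM; have [] := near_chain k _ kM (or_intror erefl).
  - apply: subspace_sum; first exact: span_subspace.
    move=> k _; apply: subspaceZ; first exact: span_subspace.
    by have [] := near_chain k _ (ltn_ord k) (or_introl erefl).
  - by move=> k kM; have [] := near_chain k _ kM (or_introl erefl).
have stable : subspace (deriv_stable_part W).
  exact/deriv_stable_part_subspace/span_subspace.
have all_stable z : P z -> deriv_stable_part W (e z).
  apply: (recurrence_propagates (P := P) (e := e) chain_up
    (chain_recurrence f_rec) (z0 := M%:Z)) => //.
    exact: chain_nonneg.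
  move=> k km; have PMk : P (M%:Z + k%:Z) by apply: chain_nonneg; lia.
  split; first exact: chain_in_window.
  exists (cls (deriv_on I (f (chain (M%:Z + k%:Z))))); first by apply: rule; lia.
  apply: (derivable_on_class_deriv _ I_limit) => x Ix.
  exact: (f_diff _ _ PMk Ix).
apply: span_le; first exact: stable.
by move=> _ [k _ <-]; apply: all_stable; exact: chain_nonneg.
Qed.

Lemma chain_derivn l : (exists k : nat, l = n + k%:R \/ l = n - k%:R) -> D l -> forall j,
  W (cls (derivn_on I j (f l))) /\
  finite_set [set x | I x /\ ~ derivable_on I (derivn_on I j (f l)) x].
Proof.
have n0 : n = chain 0 by rewrite /chain mulr0 addr0.
move=> [k]; rewrite {1 2}n0 => /chain_shift[z -> _] Pz.
by apply: derivn_on_stable => //; [exact: window_deriv_stable|exact: chain_in_window].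
Qed.

Lemma chain_dim_le : dim_le (shift_space g D I f n) m.
Proof.
rewrite (_ : shift_space g D I f n = W); first exact: span_range_dim_le.
apply/seteqP; split; apply: span_le; try exact: span_subspace.
  move=> _ [j [k [l [lk Dl ->]]]].
  by have [] := chain_derivn (ex_intro _ k lk) Dl j.
move=> _ [k _ <-]; apply: span_incl; exists 0%N, k, (chain k%:Z).
split=> //; last exact: chain_nonneg.
by rewrite /chain; case: s_unit => ->; rewrite ?mul1r ?mulN1r; [left|right].
Qed.

End Chain.

Lemma shifted_member j k n : D (n - k%:R) ->
  shift_space g D I f n (cls (derivn_on I j (f (n - k%:R)))).
Proof. by move=> Dl; apply: span_incl; exists j, k, (n - k%:R); split=> //; right. Qed.

(** The m + 1 members f_n, ..., f_(n-m) lie in an m-dimensional space, hence are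
    related; the end coefficients are nonzero as both families of m consecutive
    members are independent.  Clearing denominators gives polynomials, and
    continuity turns the equation between classes into one at every point. *)
Lemma finite_dim_recurrence : differentiable_family D I f ->
  (forall n, D n -> has_dim (shift_space g D I f n) m) ->
  independent_shifts g D I f m -> recurrence g D I f m.
Proof.
move=> f_diff f_dim f_indep.
suff /choice[q qP] : forall n, exists q : nat -> {poly K},
    (forall k, (k <= m)%N -> D (n - k%:R)) ->
    [/\ q 0%N <> 0, q m <> 0 & forall x, I x ->
        \sum_(k < m.+1) poly_eval iota (q k) x * f (n - k%:R) x = 0].
  by exists q.
move=> n.
have [Dn|] := pselect (forall k, (k <= m)%N -> D (n - k%:R)); last by exists (fun=> 0).
have Dn0 : D n by have := Dn 0%N isT; rewrite subr0.
pose v (k : 'I_m.+1) := cls (f (n - k%:R)).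
have /(has_dim_dependent (f_dim _ Dn0)) : forall k, shift_space g D I f n (v k).
  by move=> k; apply: (@shifted_member 0%N); apply: Dn; rewrite -ltnS.
move=> /existsNP[a /not_implyP[av /existsNP[i /eqP ai]]].
have a0 : a ord0 != 0.
  apply: coef_neq0 av ai.
  have shift (k : nat) : n - 1 - k%:R = n - k.+1%:R by rewrite -addrA -opprD nat1r.
  rewrite (_ : v \o _ = fun k : 'I_m => cls (f (n - 1 - k%:R))); last first.
    by apply/funext => k; rewrite /v /= /bump add1n shift.
  by apply: f_indep => k km; rewrite shift; exact: Dn.
have am : a ord_max != 0.
  apply: coef_neq0 av ai.
  rewrite (_ : v \o _ = fun k : 'I_m => cls (f (n - k%:R))); last first.
    by apply/funext => k; rewrite /v /comp lift_max.
  by apply: f_indep => k km; apply: Dn; exact: ltnW.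
have [d d0 [p pE]] := common_denominator a.
have p_neq0 k : a k != 0 -> p k <> 0.
  by move=> ak; apply/eqP; rewrite -tofrac_eq0 pE mulf_eq0 negb_or tofrac_eq0 d0 ak.
exists (fun k => p (inord k)) => _; split.
- by rewrite (_ : inord 0 = ord0); [exact: p_neq0|apply: val_inj; rewrite /= inordK].
- by rewrite (_ : inord m = ord_max); [exact: p_neq0|apply: val_inj; rewrite /= inordK].
pose F x := \sum_(k < m.+1) poly_eval iota (p (inord k)) x * f (n - k%:R) x.
apply: (cls_eq0_continuous (iota := iota) I_limit (f := F)) => [x Ix|].
  apply: has_deriv_cvg; apply: has_deriv_sum => k; apply: has_derivM.
    exact: has_deriv_horner.
  apply/(derivable_onP _ _ (I_limit Ix)); split=> //; apply: f_diff => //.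
  by apply: Dn; rewrite -ltnS.
rewrite (cls_sum iota I (fun (k : 'I_m.+1) x =>
  poly_eval iota (p (inord k)) x * f (n - k%:R) x)).
transitivity (d%:F *: \sum_(k < m.+1) a k *: v k); last by rewrite av scaler0.
rewrite scaler_sumr; apply: eq_bigr => k _.
by rewrite -scale_tofrac_cls inord_val pE scalerA.
Qed.

(** The members f_n, ..., f_(n-m+1) form a basis of the shift space, which
    contains the derivative of f_n. *)
Lemma finite_dim_backward_rule : (0 < m)%N ->
  (forall n, D n -> has_dim (shift_space g D I f n) m) ->
  independent_shifts g D I f m -> backward_rule g D I f m.
Proof.
move=> m0 f_dim f_indep.
suff /choice[r rP] : forall n, exists r : nat -> Kx,
    (forall k, (k < m)%N -> D (n - k%:R)) ->
    cls (deriv_on I (f n)) = \sum_(k < m) r k *: cls (f (n - k%:R)).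
  by exists r.
move=> n.
have [Dn|] := pselect (forall k, (k < m)%N -> D (n - k%:R)); last by exists (fun=> 0).
have Dn0 : D n by have := Dn 0%N m0; rewrite subr0.
have f_in (k : 'I_m) : shift_space g D I f n (cls (f (n - k%:R))).
  by apply: (@shifted_member 0%N); exact: Dn.
have f'_in : shift_space g D I f n (cls (deriv_on I (f n))).
  by have := @shifted_member 1 0 n; rewrite subr0; apply.
have [a ->] := (span_rangeP _ _).1
  (has_dim_indep_spans (f_dim _ Dn0) f_in (f_indep _ Dn) f'_in).
(* only the values at k < m matter; 0 is a filler beyond *)
exists (fun k => if insub k is Some i then a i else 0) => _.
by apply: eq_bigr => k _; rewrite valK.
Qed.

End AdmissibleFamilies.

Theorem theorem1 (R : realType) (g : ground) (D I : set (complexes R))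
    (f : complexes R -> complexes R -> complexes R) (m : nat)
    (hD : index_set D) (hI : variable_set I) (hm : (0 < m)%N) :
  (admissible g D I f m ->
     smooth_family D I f /\
     forall n, D n -> dim_le (shift_space g D I f n) m) /\
  (smooth_family D I f ->
   (forall n, D n -> has_dim (shift_space g D I f n) m) ->
   independent_shifts g D I f m ->
   admissible g D I f m).
Proof.
have [_ I_limit] := hI.
split=> [f_adm|[f_diff _] f_dim f_indep].
  have [s s_unit D_up] : exists2 s : complexes R,
      s = 1 \/ s = - 1 & forall l, D l -> D (l + s).
    by case: hD => D_up; [exists 1; [left|]|exists (- 1); [right|]].
  split; last by move=> n Dn; exact: (chain_dim_le I_limit Dn s_unit D_up f_adm).
  split; first by have [_ []] := f_adm.
  move=> n j Dn; have n0 : exists k : nat, n = n + k%:R \/ n = n - k%:R.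
    by exists 0%N; left; rewrite addr0.
  by have [] := chain_derivn I_limit Dn s_unit D_up f_adm n0 Dn j.
split; first exact: finite_dim_recurrence.
by split=> //; exists m => //; left; exact: finite_dim_backward_rule.
Qed.
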